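(* Consider an imprecise Markov chain with finite state set $\mathcal{X}$ and time horizon $N$. For any $n\in\{1,\dots,N-1\}$, any $x_{1:n}\in\mathcal{X}^n$ and any real-valued map $f$ on $\mathcal{X}^N$: $$\overline{E}(f\mid x_{1:n})=\overline{\mathbb{T}}_n\overline{\mathbb{T}}_{n+1}\cdots\overline{\mathbb{T}}_{N-1}f(x_{1:n})$$ and $$\overline{E}(f)=\overline{E}_1(\overline{\mathbb{T}}_1\overline{\mathbb{T}}_2\cdots\overline{\mathbb{T}}_{N-1}f).$$
   Context: $\mathcal{X}$ is a finite non-empty set, $\mathcal{L}(\mathcal{Y})$ is the set of real-valued maps on a finite set $\mathcal{Y}$, and $\Sigma_{\mathcal{X}}$ is the set of probability mass functions on $\mathcal{X}$. A credal set is a non-empty closed convex subset of $\Sigma_{\mathcal{X}}$. We write $x_{k:\ell}=(x_k,\dots,x_\ell)$. An imprecise Markov chain with state set $\mathcal{X}$ and time horizon $N$ consists of a credal set $\mathcal{M}_1$ (for the initial state $X(1)$) and, for each $n\in\{1,\dots,N-1\}$ and $x\in\mathcal{X}$, a credal set $\mathcal{Q}_n(\cdot\mid x)$ (for the state $X(n+1)$ given $X(n)=x$). For $h\in\mathcal{L}(\mathcal{X})$: $\overline{E}_1(h)=\max\{\sum_{x}h(x)m(x): m\in\mathcal{M}_1\}$, and the upper transition operator $\overline{T}_n:\mathcal{L}(\mathcal{X})\to\mathcal{L}(\mathcal{X})$ is $\overline{T}_nh(x)=\max\{\sum_{z}h(z)q(z):q\in\mathcal{Q}_n(\cdot\mid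 x)\}$. The map $\overline{\mathbb{T}}_n:\mathcal{L}(\mathcal{X}^{n+1})\to\mathcal{L}(\mathcal{X}^n)$ is given by $\overline{\mathbb{T}}_nf(x_{1:n})=\big(\overline{T}_n f(x_{1:n},\cdot)\big)(x_n)$. A compatible probability tree is a choice of some $m_1\in\mathcal{M}_1$ and, for every $k\in\{1,\dots,N-1\}$ and every $x_{1:k}\in\mathcal{X}^k$, of some $q(\cdot\mid x_{1:k})\in\mathcal{Q}_k(\cdot\mid x_k)$ (the choice may depend on the whole of $x_{1:k}$). Its expectations are, for $f\in\mathcal{L}(\mathcal{X}^N)$, $$E(f\mid x_{1:n})=\sum_{x_{n+1:N}\in\mathcal{X}^{N-n}}f(x_{1:n},x_{n+1:N})\prod_{k=n}^{N-1}q(x_{k+1}\mid x_{1:k}),$$ $$E(f)=\sum_{x_{1:N}\in\mathcal{X}^N}f(x_{1:N})\,m_1(x_1)\prod_{k=1}^{N-1}q(x_{k+1}\mid x_{1:k}).$$ $\overline{E}(f\mid x_{1:n})$ and $\overline{E}(f)$ denote the maxima of $E(f\mid x_{1:n})$ and $E(f)$, respectively, over all compatible probability trees. *)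

(* Defs.v *)
From HB Require Import structures.
From mathcomp Require Import all_boot all_order all_algebra.
From mathcomp Require Import all_classical all_reals all_analysis.

Set Implicit Arguments.
Unset Strict Implicit.
Unset Printing Implicit Defensive.

Import Order.TTheory GRing.Theory Num.Theory.
Import numFieldNormedType.Exports.

Local Open Scope classical_set_scope.
Local Open Scope ring_scope.

Section Maximum.
Context {R : realType}.
Implicit Type A : set R.

Definition is_max A (m : R) := A m /\ ubound A m.

Definition has_max A := exists m, is_max A m.

(* The default value 0 is used only when [A] has no maximum. *)
Definition maxr A : R := xget 0 (is_max A).

Lemma is_maxE A m : is_max A m -> maxr A = m.
Proof.
move=> [Am ubm]; rewrite /maxr; case: xgetP => [y _ [Ay uby]|/(_ m)].
  by apply/eqP; rewrite eq_le ubm// uby.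
by case; split.
Qed.

End Maximum.

Section CredalSet.
Context {R : realType} {X : finType}.

Definition pmf : set (X -> R) :=
  [set p | (forall x, 0 <= p x) /\ \sum_x p x = 1].

(* [X] being finite, the topology of pointwise convergence is the Euclidean
   topology of the space of real-valued maps on [X]. *)
Definition credal_set (A : set (X -> R)) :=
  [/\ A !=set0, A `<=` pmf, closed (A : set {ptws X -> R}) & convex_set A].

Definition upper_expectation (A : set (X -> R)) (h : X -> R) : R :=
  maxr [set \sum_x h x * p x | p in A].

Lemma has_max_credal (A : set (X -> R)) (h : X -> R) : credal_set A ->
  has_max [set \sum_x h x * p x | p in A].
Proof.
move=> [A0 Apmf Acl _].
have cA : compact (A : set {ptws X -> R}).
  have cK : compact [set p : {ptws X -> R} | forall x, `[(0 : R), 1]%classic (p x)].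
    apply: (@tychonoff X (fun=> R) (fun=> `[0, 1]%classic)) => x.
    exact: segment_compact.
  apply: subclosed_compact Acl cK _.
  move=> p /Apmf[p0 p1] x /=; rewrite in_itv/= p0 -p1 (bigD1 x)//= lerDl.
  exact: sumr_ge0.
pose F (p : {ptws X -> R}) : R := \sum_x h x * p x.
have cF : continuous F.
  apply: continuous_big => [|x _ p]; first exact: add_continuous.
  have px : {for p, continuous (fun p : {ptws X -> R} => p x)}.
    exact: (@proj_continuous X (fun=> R) x p).
  have := @cvgM R _ (nbhs p) _ (cst (h x)) (fun q => q x) (h x) (p x) _ px.
  by apply; exact: cvg_cst.
have cFA : compact (F @` A).
  by apply: continuous_compact cA; apply: continuous_subspaceT.
have FA0 : F @` A !=set0 by exact: image_nonempty.
have [M [_ MA]] := compact_bounded cFA.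
have ubF : has_ubound (F @` A).
  exists (M + 1) => y Fy; apply: le_trans (ler_norm _) _.
  by apply: MA Fy; rewrite ltrDl.
exists (sup (F @` A)); split; last exact: ub_le_sup.
apply: (compact_closed _ cFA); last exact: closure_sup.
exact: norm_hausdorff.
Qed.

End CredalSet.

(* [initial] is the credal set of the state at time 1 and, for 1 <= n < N,
   [transition n x] is that of the state at time n + 1 given that the state at
   time n is [x]; the values of [transition] at other [n] are irrelevant. *)
Record imprecise_markov_chain (R : realType) (X : finType) (N : nat) := {
  initial : set (X -> R) ;
  transition : nat -> X -> set (X -> R) ;
  initial_credal : credal_set initial ;
  transition_credal : forall n x, (0 < n < N)%N -> credal_set (transition n x)
}.

Section Operators.
Context {R : realType} {X : finType} {N : nat}.
Variables (x0 : X) (C : imprecise_markov_chain R X N).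

Definition upper_initial (h : X -> R) : R := upper_expectation (initial C) h.

Definition upper_transition (n : nat) (h : X -> R) : X -> R :=
  fun x => upper_expectation (transition C n x) h.

(* [last x0 x] is the last component of [x] as soon as [0 < n]. *)
Definition upper_step (n : nat) (f : n.+1.-tuple X -> R) : n.-tuple X -> R :=
  fun x => upper_transition n (fun z => f [tuple of rcons x z]) (last x0 x).

Fixpoint upper_steps (d n : nat) : ((d + n).-tuple X -> R) -> n.-tuple X -> R :=
  match d with
  | 0 => fun f => f
  | d'.+1 => fun f => upper_steps (@upper_step (d' + n) f)
  end.

(* The composition of [upper_step n], ..., [upper_step N.-1], applied to [f];
   it is [f] itself when [n = N]. *)
Definition upper_steps_from (n : nat) (nN : (n <= N)%N) (f : N.-tuple X -> R) :
    n.-tuple X -> R :=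
  upper_steps (d := N - n) (fun y => f (tcast (subnK nN) y)).

End Operators.

(* [tree_transition s] is the mass function of the next state after the
   history [s]; only nonempty histories of length less than the horizon
   matter. That these are mass functions follows from [compatible] below. *)
Record probability_tree (R : realType) (X : finType) := {
  tree_initial : X -> R ;
  tree_transition : seq X -> X -> R
}.

Section Trees.
Context {R : realType} {X : finType} {N : nat}.
Variable x0 : X.
Implicit Types (C : imprecise_markov_chain R X N) (t : probability_tree R X).

Definition compatible C t :=
  initial C (tree_initial t) /\
  forall k (x : k.-tuple X), (0 < k < N)%N ->
    transition C k (last x0 x) (tree_transition t x).

(* Times start at 1 whereas components of tuples are numbered from 0: the
   state at time [k + 1] on the path [w] is [nth x0 w k], and the history up to
   time [k] is [take k w]. *)
Definition path_prob t (n : nat) (w : N.-tuple X) : R :=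
  \prod_(n <= k < N) tree_transition t (take k w) (nth x0 w k).

Definition tree_cond_expectation t (n : nat) (nN : (n <= N)%N)
    (f : N.-tuple X -> R) (x : n.-tuple X) : R :=
  \sum_(y : (N - n).-tuple X)
    let w := tcast (subnKC nN) [tuple of x ++ y] in f w * path_prob t n w.

Definition tree_expectation t (f : N.-tuple X -> R) : R :=
  \sum_(w : N.-tuple X) f w * tree_initial t (nth x0 w 0) * path_prob t 1 w.

Definition tree_cond_expectations C (n : nat) (nN : (n <= N)%N)
    (f : N.-tuple X -> R) (x : n.-tuple X) : set R :=
  [set tree_cond_expectation t nN f x | t in compatible C].

Definition tree_expectations C (f : N.-tuple X -> R) : set R :=
  [set tree_expectation t f | t in compatible C].

Definition upper_cond_tree_expectation C (n : nat) (nN : (n <= N)%N)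
    (f : N.-tuple X -> R) (x : n.-tuple X) : R :=
  maxr (tree_cond_expectations C nN f x).

Definition upper_tree_expectation C (f : N.-tuple X -> R) : R :=
  maxr (tree_expectations C f).

End Trees.

(* Main.v *)
Require Import Defs.
From mathcomp Require Import all_boot all_order all_algebra.
From mathcomp Require Import all_classical all_reals all_analysis.

(** Both sides of each identity satisfy a backward recursion over histories.
   For a probability tree, the expectation of the gamble given the history [s]
   is the average, over the next state [z], of the expectation given [rcons s z]
   ([tree_value], [tree_valueE]). For the composed upper transition operators,
   the average is replaced by the upper expectation of the credal set at the
   last state of [s] ([upper_value], [upper_steps_value]).

   A compatible tree uses a mass function of that credal set at every history,
   so, by induction on the remaining time, its expectations never exceed the
   upper ones ([tree_value_le]). The mass functions at distinct histories can be
   chosen independently of each other, and the upper expectation of a credal set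
   is attained. The tree that picks, at every history, a maximiser of the upper
   value at the next time is therefore compatible and attains all the upper
   values at once ([optimal_tree_exists]). The unconditional identity follows
   by one more step of the same argument, at the initial credal set. *)

Set Implicit Arguments.
Unset Strict Implicit.
Unset Printing Implicit Defensive.

Import Order.TTheory GRing.Theory Num.Theory.

Local Open Scope classical_set_scope.
Local Open Scope ring_scope.

Lemma big_tuple_cons (R : nmodType) (X : finType) (d : nat)
    (G : d.+1.-tuple X -> R) :
  \sum_(y : d.+1.-tuple X) G y =
  \sum_(z : X) \sum_(y : d.-tuple X) G [tuple of z :: y].
Proof.
rewrite pair_big /= (reindex (fun p : X * d.-tuple X => [tuple of p.1 :: p.2])).
  by [].
exists (fun y => (thead y, [tuple of behead y])) => [[z y] _|y _] /=.
  by congr (_, _); apply/val_inj.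
by rewrite -tuple_eta.
Qed.

Section UpperExpectation.
Context {R : realType} {X : finType}.
Implicit Types (A : set (X -> R)) (h p : X -> R).

Lemma upper_expectation_is_max A h : credal_set A ->
  is_max [set \sum_x h x * p x | p in A] (upper_expectation A h).
Proof.
by move=> /(has_max_credal h)[m mA]; rewrite /upper_expectation (is_maxE mA).
Qed.

Lemma upper_expectation_ge A h p : credal_set A -> A p ->
  \sum_x h x * p x <= upper_expectation A h.
Proof. by move=> /(upper_expectation_is_max h)[_ ub] Ap; apply: ub; exists p. Qed.

Lemma upper_expectation_attained A h : credal_set A ->
  exists2 p, A p & \sum_x h x * p x = upper_expectation A h.
Proof. by move=> /(upper_expectation_is_max h)[[p Ap <-] _]; exists p. Qed.

Lemma ler_expectation A h h' p : credal_set A -> A p ->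
  (forall x, h x <= h' x) -> \sum_x h x * p x <= \sum_x h' x * p x.
Proof.
move=> [_ Apmf _ _] /Apmf[p0 _] hh'.
by apply: ler_sum => x _; apply: ler_wpM2r.
Qed.

End UpperExpectation.

Section Values.
Context {R : realType} {X : finType} {N : nat}.
Variables (x0 : X) (C : imprecise_markov_chain R X N).
Implicit Types (t : probability_tree R X) (F : seq X -> R) (s : seq X).

(** Value, at the history [s], of the backward recursion driven by the upper
   transition operators over [d] steps, with final values [F]. Histories are
   sequences rather than tuples, so that times are read off from their sizes. *)
Fixpoint upper_value F (d : nat) s : R :=
  if d is d'.+1 then
    upper_transition C (size s) (fun z => upper_value F d' (rcons s z))
      (last x0 s)
  else F s.

(** The same recursion, driven by the transition mass functions of a tree. *)
Fixpoint tree_value t F (d : nat) s : R :=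
  if d is d'.+1 then
    \sum_z tree_value t F d' (rcons s z) * tree_transition t s z
  else F s.

Lemma upper_steps_value F (d e n : nat) (x : n.-tuple X) :
  upper_steps x0 C (d := d) (fun y => upper_value F e y) x =
  upper_value F (d + e) x.
Proof.
elim: d e => [//|d IH] e.
rewrite (addSnnS d e) -IH /=; congr (upper_steps _ _ _ _).
by apply/funext => y; rewrite /upper_step size_tuple.
Qed.

Lemma tree_valueE t F d s :
  tree_value t F d s =
  \sum_(y : d.-tuple X) F (s ++ y) *
    \prod_(size s <= k < size s + d)
      tree_transition t (take k (s ++ y)) (nth x0 (s ++ y) k).
Proof.
elim: d s => [|d IH] s /=.
  rewrite (big_pred1 [tuple]) => [|y]; last first.
    by apply/esym/eqP; exact: tuple0.
  by rewrite cats0 big_geq ?addn0// mulr1.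
rewrite big_tuple_cons; apply: eq_bigr => z _.
rewrite IH big_distrl; apply: eq_bigr => y _ /=.
rewrite cat_rcons size_rcons addSnnS -mulrA; congr (_ * _).
rewrite [in RHS]big_ltn; last by rewrite addnS ltnS leq_addr.
by rewrite take_size_cat// nth_cat ltnn subnn /= mulrC.
Qed.

Lemma tree_value_le t F d s : compatible x0 C t ->
  (0 < size s)%N -> (size s + d <= N)%N ->
  tree_value t F d s <= upper_value F d s.
Proof.
move=> [_ tC]; elim: d s => [//|d IH] s s0 sN /=.
have sN' : (0 < size s < N)%N.
  by rewrite s0 (leq_trans _ sN)// addnS ltnS leq_addr.
have cr := transition_credal C (last x0 s) sN'.
have Ct : transition C (size s) (last x0 s) (tree_transition t s).
  exact: (tC _ (in_tuple s)).
apply: (le_trans _ (upper_expectation_ge _ cr Ct)).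
apply: (ler_expectation cr Ct) => z.
by apply: IH; rewrite size_rcons// addSnnS.
Qed.

(** One and the same tree attains the upper values, with final time [N], at all
   nonempty histories at once: the mass functions at distinct histories are
   chosen independently, each among the maximisers at its history. Its initial
   mass function maximises the expectation of an arbitrary gamble [h]. *)
Lemma optimal_tree_exists F (h : X -> R) : exists t, [/\ compatible x0 C t,
  \sum_z h z * tree_initial t z = upper_initial C h &
  forall d s, (0 < size s)%N -> (size s + d = N)%N ->
    tree_value t F d s = upper_value F d s].
Proof.
have [m mC mE] := upper_expectation_attained h (initial_credal C).
(* At a history of size less than [N], [next s] is the upper value, with final
   time [N], one step after [s], as a function of the next state. *)
pose next s z := upper_value F (N - size s).-1 (rcons s z).
pose optimal s (p : X -> R) := (0 < size s < N)%N ->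
  transition C (size s) (last x0 s) p /\
  \sum_z next s z * p z = upper_transition C (size s) (next s) (last x0 s).
have /boolp.choice[q qP] : forall s, exists p, optimal s p.
  move=> s; rewrite /optimal.
  have [sN|sN] := boolP (0 < size s < N)%N; last by exists (fun=> 0).
  have [p pC pE] := upper_expectation_attained (next s)
    (transition_credal C (last x0 s) sN).
  by exists p.
exists {| tree_initial := m; tree_transition := q |}; split => //.
  split => // k x kN.
  by have := qP x; rewrite /optimal size_tuple => /(_ kN)[].
elim=> [//|d IH] s s0 sN /=.
have sN' : (0 < size s < N)%N by rewrite s0 -sN addnS ltnS leq_addr.
have [_] := qP s sN'; rewrite /next.
have -> : (N - size s)%N = d.+1 by rewrite -sN addKn.
move=> /= <-; apply: eq_bigr => z _.
by rewrite IH// size_rcons// addSnnS.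
Qed.

Section Gamble.
Variable f : N.-tuple X -> R.

(** The gamble [f] as a function of sequences; its values at sequences of
   length other than [N] are irrelevant. *)
Definition gamble_seq s : R := f (insubd [tuple of nseq N x0] s).

Lemma gamble_seqE (w : N.-tuple X) : gamble_seq w = f w.
Proof. by rewrite /gamble_seq valKd. Qed.

Lemma tree_cond_expectation_value t (n : nat) (nN : (n <= N)%N)
    (x : n.-tuple X) :
  tree_cond_expectation x0 t nN f x = tree_value t gamble_seq (N - n) x.
Proof.
rewrite tree_valueE; apply: eq_bigr => y _.
rewrite /path_prob -gamble_seqE val_tcast /= (size_tuple x).
by rewrite subnKC.
Qed.

Lemma upper_steps_from_value (n : nat) (nN : (n <= N)%N) (x : n.-tuple X) :
  upper_steps_from x0 C nN f x = upper_value gamble_seq (N - n) x.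
Proof.
rewrite -[in RHS](addn0 (N - n)%N) -upper_steps_value.
congr (upper_steps _ _ _ _); apply/funext => y /=.
by rewrite -gamble_seqE val_tcast.
Qed.

End Gamble.

End Values.

Lemma tree_expectation_value (R : realType) (X : finType) (x0 : X) (N : nat)
    (t : probability_tree R X) (f : N.-tuple X -> R) : (0 < N)%N ->
  tree_expectation x0 t f =
  \sum_z tree_value t (gamble_seq x0 f) (N - 1) [:: z] * tree_initial t z.
Proof.
case: N f => [//|d] f _; rewrite subn1 /= /tree_expectation big_tuple_cons.
apply: eq_bigr => z _; rewrite (tree_valueE x0) big_distrl.
by apply: eq_bigr => y _; rewrite -(gamble_seqE x0) /= mulrAC.
Qed.

Theorem theorem3p1 (R : realType) (X : finType) (x0 : X) (N : nat)
    (N_gt0 : (0 < N)%N) (C : imprecise_markov_chain R X N)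
    (f : N.-tuple X -> R) :
  (forall (n : nat) (n_gt0 : (0 < n)%N) (n_ltN : (n < N)%N) (x : n.-tuple X),
     has_max (tree_cond_expectations x0 C (ltnW n_ltN) f x) /\
     upper_cond_tree_expectation x0 C (ltnW n_ltN) f x
       = upper_steps_from x0 C (ltnW n_ltN) f x) /\
  (has_max (tree_expectations x0 C f) /\
   upper_tree_expectation x0 C f
     = upper_initial C (fun z => upper_steps_from x0 C N_gt0 f [tuple z])).
Proof.
set h := fun z => upper_steps_from x0 C N_gt0 f [tuple z].
have [t [tC th tV]] := optimal_tree_exists x0 C (gamble_seq x0 f) h.
have hE z : h z = upper_value x0 C (gamble_seq x0 f) (N - 1) [:: z].
  exact: upper_steps_from_value.
split=> [n n_gt0 n_ltN x|].
  suff max : is_max (tree_cond_expectations x0 C (ltnW n_ltN) f x)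
      (upper_steps_from x0 C (ltnW n_ltN) f x).
    by split; [exists (upper_steps_from x0 C (ltnW n_ltN) f x)|exact: is_maxE].
  rewrite upper_steps_from_value; split.
    exists t => //; rewrite tree_cond_expectation_value.
    by apply: tV; rewrite size_tuple// subnKC// ltnW.
  move=> _ [t' t'C <-]; rewrite tree_cond_expectation_value.
  by apply: tree_value_le; rewrite // size_tuple// subnKC// ltnW.
suff max : is_max (tree_expectations x0 C f) (upper_initial C h).
  by split; [exists (upper_initial C h)|exact: is_maxE].
split.
  exists t => //; rewrite tree_expectation_value// -th.
  by apply: eq_bigr => z _; rewrite hE tV// subnKC.
move=> _ [t' t'C <-]; rewrite tree_expectation_value//.
have cr := initial_credal C; have Ct' := t'C.1.
apply: (le_trans _ (upper_expectation_ge _ cr Ct')).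
apply: (ler_expectation cr Ct') => z; rewrite hE.
by apply: tree_value_le => //=; rewrite subnKC.
Qed.
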